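(* Let $\mathcal{P}_0\subset\mathcal{P}$. Suppose that there exist (i) a deterministic rate function $g$ tending to zero as $n\to\infty$ such that $\mathcal{D}^{(n)}_{\mathcal{T}}\in\mathcal{O}_{\mathcal{P}_0}(g(n))$, and (ii) a finite constant $C$ such that, for every $P\in\mathcal{P}_0$, the conditional density $f_{X\mid Z}$ of $X$ given $Z$ satisfies $\sup_{x\in[0,1]}f_{X\mid Z}(x\mid z)\le C$ for almost all $z\in[0,1]^d$. Then $$\|F-\hat F^{(m_n,n)}\|_{\mathcal{T},\infty}\in\mathcal{O}_{\mathcal{P}_0}(g(n)),$$ given that the equidistant grids $(\tau_k)_{k=1}^{m_n}$ in $\mathcal{T}$ satisfy $\kappa_{m_n}\in o(g(n))$.
   Context: $\mathcal{P}$ is the set of distributions of $(X,Y,Z)$ on $[0,1]^{2+d}$ ($X,Y\in[0,1]$, $Z\in[0,1]^d$) that are absolutely continuous with respect to Lebesgue measure. Throughout, for every $z$ the conditional distribution of $X$ given $Z=z$ is continuous. $F(t\mid z)=P(X\le t\mid Z=z)$ is the conditional distribution function and $Q(\tau\mid z)=\inf\{t\in[0,1]: F(t\mid z)\ge\tau\}$ the conditional quantile function of $X$ given $Z=z$ under $P$. Fix $0<\tau_{\min}<\tau_{\max}<1$ and put $\mathcal{T}=[\tau_{\min},\tau_{\max}]$, $Q(\mathcal{T}\mid z)=[Q(\tau_{\min}\mid z),Q(\tau_{\max}\mid z)]$. For $f:[0,1]\times[0,1]^d\to\mathbb{R}$, $\|f\|_{\mathcal{T},\infty}=\sup_{z\in[0,1]^d}\sup_{t\in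 Q(\mathcal{T}\mid z)}|f(t,z)|$. A grid in $\mathcal{T}$ is a sequence $\tau_{\min}=\tau_1<\dots<\tau_m=\tau_{\max}$ with $m\ge2$; it is equidistant if $\tau_{k+1}-\tau_k$ is constant for $k=1,\dots,m-1$; its coarseness is $\kappa_m=\max_{k=1,\dots,m-1}(\tau_{k+1}-\tau_k)$. Put $\tau_0=0$, $\tau_{m+1}=1$. $\hat Q^{(n)}(\tau\mid z)$ denotes the predicted conditional $\tau$-quantile of a quantile regression procedure fitted on an i.i.d. sample $(X_i,Z_i)_{i=1}^n$ from $P$, and $\mathcal{D}^{(n)}_{\mathcal{T}}=\sup_{z\in[0,1]^d}\sup_{\tau\in\mathcal{T}}|Q(\tau\mid z)-\hat Q^{(n)}(\tau\mid z)|$. Given a grid, let $\hat q_{0,z}=0$, $\hat q_{m+1,z}=1$, $\hat q_{k,z}=\hat Q^{(n)}(\tau_k\mid z)$ for $k=1,\dots,m$ (if these estimated quantiles cross, i.e. are not increasing in $k$, they are re-arranged in increasing order). The estimator is the linear interpolation $$\hat F^{(m,n)}(t\mid z)=\sum_{k=0}^m\Big(\tau_k+(\tau_{k+1}-\tau_k)\frac{t-\hat q_{k,z}}{\hat q_{k+1,z}-\hat q_{k,z}}\Big)1_{(\hat q_{k,z},\hat q_{k+1,z}]}(t),\quad t\in[0,1].$$ For a set of distributions $\mathcal{M}$ and a nonzero sequence $a_n$, $X_n\in\mathcal{O}_{\mathcal{M}}(a_n)$ means: for every $\epsilon>0$ there is $M>0$ with $\sup_{n\in\mathbb{N}}\s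up_{P\in\mathcal{M}}P(|X_n/a_n|>M)<\epsilon$.
   Formalization: Both suprema over z (in the quantile error and in the norm of F minus its estimator) exclude an exceptional null set of z off which the density bound (ii) holds; with suprema over all z in the cube and (ii) only for almost all z, the claim is false. *)

(* Defs.v *)
From HB Require Import structures.
From mathcomp Require Export all_boot all_order all_algebra.
From mathcomp Require Export finmap.
From mathcomp Require Export all_classical all_reals all_analysis.

Export Order.TTheory GRing.Theory Num.Theory.
Export numFieldNormedType.Exports.

Set Implicit Arguments.
Unset Strict Implicit.
Unset Printing Implicit Defensive.

Local Open Scope classical_set_scope.
Local Open Scope ring_scope.

(* R^d, R^{2+d} with coordinates ((x, y), z), and R^{1+d} with coordinates
   (x, z), each with its product Borel sigma-algebra. *)
Definition covT (R : realType) (d : nat) : measurableType _ :=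
  d.-tuple (measurableTypeR R).

Definition tripleT (R : realType) (d : nat) : measurableType _ :=
  (measurableTypeR R * measurableTypeR R * covT R d)%type.

Definition pairT (R : realType) (d : nat) : measurableType _ :=
  (measurableTypeR R * covT R d)%type.

Definition cube (R : realType) (d : nat) : set (covT R d) :=
  [set z | forall i : 'I_d, 0 <= tnth z i <= 1].

Definition cube3 (R : realType) (d : nat) : set (tripleT R d) :=
  [set w | [/\ 0 <= w.1.1 <= 1, 0 <= w.1.2 <= 1 & cube w.2]].

(* The library has no Lebesgue measure on tuples: integrate over the first
   coordinate. *)
Fixpoint lebesgue_tuple (R : realType) (d : nat) : set (covT R d) -> \bar R :=
  match d with
  | 0 => fun A => \d_([tuple] : covT R 0) A
  | d'.+1 => fun A =>
      (\int[lebesgue_measure]_x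
         lebesgue_tuple [set z : covT R d' | A [tuple of x :: z]])%E
  end.

Definition lebesgue3 (R : realType) (d : nat) : set (tripleT R d) -> \bar R :=
  ((lebesgue_measure \x lebesgue_measure) \x @lebesgue_tuple R d)%E.

Definition law (R : realType) (d : nat) := probability (tripleT R d) R.

Definition calP (R : realType) (d : nat) : set (law R d) :=
  [set P | P (@cube3 R d) = 1%E /\ P `<< @lebesgue3 R d].

(* K z is the distribution of X given Z = z under P.  This determines K only
   up to a null set of z. *)
Definition is_cond_law (R : realType) (d : nat) (P : law R d)
    (K : R.-pker (covT R d) ~> (measurableTypeR R)) : Prop :=
  forall (A : set (measurableTypeR R)) (B : set (covT R d)),
    measurable A -> measurable B ->
    P [set w | A w.1.1 /\ B w.2] =
      (\int[P]_(w in [set w : tripleT R d | B w.2]) K w.2 A)%E.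

Definition condF (R : realType) (d : nat)
    (K : R.-pker (covT R d) ~> (measurableTypeR R))
    (t : R) (z : covT R d) : R :=
  fine (K z `]-oo, t]%classic).

Definition condQ (R : realType) (d : nat)
    (K : R.-pker (covT R d) ~> (measurableTypeR R))
    (tau : R) (z : covT R d) : R :=
  inf [set t | 0 <= t <= 1 /\ tau <= condF K t z].

(* A version of the conditional distribution that, for every z in the cube, is
   a distribution on [0, 1] with continuous distribution function. *)
Definition continuous_cond_law (R : realType) (d : nat) (P : law R d)
    (K : R.-pker (covT R d) ~> (measurableTypeR R)) : Prop :=
  is_cond_law P K /\
  forall z, cube z -> K z `[0, 1]%classic = 1%E /\ continuous (fun t : R => condF K t z).

(* f x z is the density of X at x given Z = z, for z in S. *)
Definition is_cond_density (R : realType) (d : nat)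
    (K : R.-pker (covT R d) ~> (measurableTypeR R)) (S : set (covT R d))
    (f : R -> covT R d -> R) : Prop :=
  [/\ measurable_fun [set: pairT R d] (fun w => f w.1 w.2),
      forall x z, 0 <= f x z &
      forall z, S z -> forall A : set (measurableTypeR R), measurable A ->
        K z A = (\int[lebesgue_measure]_(x in A) (f x z)%:E)%E].

Definition is_grid (R : realType) (taumin taumax : R) (m : nat)
    (tau : nat -> R) : Prop :=
  [/\ (2 <= m)%N, tau 1 = taumin, tau m = taumax &
      forall k, (1 <= k < m)%N -> tau k < tau k.+1].

Definition equidistant (R : realType) (m : nat) (tau : nat -> R) : Prop :=
  forall k l, (1 <= k < m)%N -> (1 <= l < m)%N ->
    tau k.+1 - tau k = tau l.+1 - tau l.

Definition coarseness (R : realType) (m : nat) (tau : nat -> R) : R :=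
  \big[Num.max/0]_(1 <= k < m) (tau k.+1 - tau k).

(* tau_0 = 0 and tau_{m+1} = 1. *)
Definition grid_ext (R : realType) (m : nat) (tau : nat -> R) (k : nat) : R :=
  if k == 0%N then 0 else if (k <= m)%N then tau k else 1.

(* qhat_0 = 0 and qhat_{m+1} = 1; the others are the estimated quantiles
   q (tau_1), ..., q (tau_m), sorted. *)
Definition qhat (R : realType) (m : nat) (tau : nat -> R) (q : R -> R)
    (k : nat) : R :=
  if k == 0%N then 0
  else if (k <= m)%N
       then nth 0 (sort <=%R [seq q (tau j) | j <- iota 1 m]) k.-1
       else 1.

(* When qhat_k = qhat_{k+1} the quotient is by 0, but the indicator is that of
   the empty set. *)
Definition Fhat (R : realType) (m : nat) (tau : nat -> R) (q : R -> R)
    (t : R) : R :=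
  \sum_(0 <= k < m.+1)
    (grid_ext m tau k + (grid_ext m tau k.+1 - grid_ext m tau k) *
       ((t - qhat m tau q k) / (qhat m tau q k.+1 - qhat m tau q k))) *
    \1_(`]qhat m tau q k, qhat m tau q k.+1]) t.

(* The suprema over z run over a set S of conditioning values, since those in a
   null set carry no information on P: S is the cube, or the cube minus a null
   set. *)
Definition quantile_sup_norm (R : realType) (d : nat)
    (K : R.-pker (covT R d) ~> (measurableTypeR R)) (taumin taumax : R)
    (S : set (covT R d)) (h : R -> covT R d -> R) : \bar R :=
  ereal_sup [set s | exists z t,
    [/\ S z, condQ K taumin z <= t <= condQ K taumax z & s = `|h t z|%:E]].

Definition quantile_error (R : realType) (d : nat)
    (K : R.-pker (covT R d) ~> (measurableTypeR R)) (taumin taumax : R)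
    (S : set (covT R d)) (q : R -> covT R d -> R) : \bar R :=
  ereal_sup [set s | exists z tau,
    [/\ S z, taumin <= tau <= taumax & s = `|condQ K tau z - q tau z|%:E]].

Definition mutually_independent (R : realType) (dO dE : measure_display)
    (Omega : measurableType dO) (E : measurableType dE)
    (Pr : probability Omega R) (V : nat -> Omega -> E) : Prop :=
  forall (J : {fset nat}) (A : nat -> set E), (forall i, measurable (A i)) ->
    Pr (\bigcap_(i in [set` J]) (V i @^-1` A i)) =
      (\prod_(i <- J) Pr (V i @^-1` A i))%E.

(* Under Pr, the V i = (X_i, Z_i) are i.i.d. with the (X, Z)-marginal of P. *)
Definition iid_sample (R : realType) (d : nat) (dO : measure_display)
    (Omega : measurableType dO) (P : law R d) (Pr : probability Omega R)
    (V : nat -> Omega -> pairT R d) : Prop :=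
  [/\ forall i, measurable_fun [set: Omega] (V i),
      forall i (A : set (pairT R d)), measurable A ->
        Pr (V i @^-1` A) = P [set w | A (w.1.1, w.2)] &
      mutually_independent Pr V].

(* X P n is O_M(a n), where Pr P is the probability on Omega when the true law
   is P.  The outer measure Pr^* extends Pr to all events, as X P n may be a
   non-measurable supremum.  The index n ranges over n >= 1. *)
Definition unif_bounded_in_prob (R : realType) (d : nat) (dO : measure_display)
    (Omega : measurableType dO) (M : set (law R d))
    (Pr : law R d -> probability Omega R)
    (X : law R d -> nat -> Omega -> \bar R) (a : nat -> R) : Prop :=
  forall e : R, 0 < e -> exists2 B : R, 0 < B &
    (ereal_sup [set s | exists n P, [/\ (0 < n)%N, M P &
       s = ((Pr P)^*)%mu [set w | B%:E < `| X P n w * (a n)^-1%:E |]]]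
     < e%:E)%E.

(* Main.v *)
Require Import Defs.
From mathcomp Require Import measurable_realfun.
From mathcomp Require Import lra zify.

Set Implicit Arguments.
Unset Strict Implicit.
Unset Printing Implicit Defensive.

Local Open Scope classical_set_scope.
Local Open Scope ring_scope.

(** The bound is deterministic: on every sample and for every conditioning value
    z outside the exceptional set, an error of at most delta on the quantiles
    forces an error of at most [coarseness + 2 * C * delta] on the distribution
    function, C being the bound on the density ([sup_norm_le_quantile_error]).  Outer measures being monotone, this
    inclusion of events transfers boundedness in probability from the quantile
    error to the error of the interpolant.

    Fix z and write F, Q for the true distribution and quantile functions, q for
    the estimated quantile function.

    The density bound makes F Lipschitz with constant C ([condF_lipschitz]), and
    continuity gives F (Q s) = s ([condF_condQ]).  Rearranging the estimated
    quantiles in increasing order does not increase their largest error, since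
    sorting is monotone in the entries and commutes with shifts ([qhat_close]).

    Every t in ]0, 1] lies in exactly one interpolation cell, even when
    estimated quantiles fall outside [0, 1] ([qhat_locate], [FhatE]).  If the
    cell is bounded by two estimated quantiles of levels tau_k and tau_{k+1},
    then the interpolant lies between these levels, and so does F t up to
    C * delta: the error is at most coarseness + C * delta.  The two outermost
    cells are not short in level, as their levels span [0, taumin] and
    [taumax, 1].  But t stays between Q taumin and Q taumax, so it is at most
    delta away from the inner end of such a cell.  Moreover the slope of the
    interpolant there is at most C: a first cell that contains t is at least as
    long as [0, Q taumin], and F needs a length of at least taumin / C to climb
    from 0 to taumin; the last cell is symmetric ([edge_weight_le]).  This is where
    delta is counted a second time ([Fhat_error]).

    The coarseness is o(g), and g vanishes at no positive index, so it is
    bounded by a constant times |g| at all positive indices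
    ([littleo_bound]). *)

(** * Rearrangement of the estimated quantiles *)

(** The k-th smallest value is at most x exactly when more than k values are at
    most x, and decreasing the values can only increase this count. *)
Lemma le_nth_sort (I : eqType) (disp : Order.disp_t) (T : orderType disp)
    (x0 : T) (s : seq I) (u v : I -> T) (k : nat) :
  (forall i, i \in s -> (u i <= v i)%O) ->
  (nth x0 (sort <=%O (map u s)) k <= nth x0 (sort <=%O (map v s)) k)%O.
Proof.
move=> uv; have [sk|ks] := leqP (size s) k.
  by rewrite !nth_default ?size_sort ?size_map.
set x := nth _ (sort _ (map v s)) _.
apply: nth_count_le; first exact: sort_le_sorted.
rewrite (permP (permEl (perm_sort _ _))).
have vk : (k < count (<= x)%O (map v s))%N.
  rewrite -(permP (permEl (perm_sort <=%O _))) ltnNge; apply/negP => ck.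
  suff : (x < x)%O by rewrite ltxx.
  apply: nth_count_gt; first exact: sort_le_sorted.
  by rewrite ck size_sort size_map.
apply: leq_trans vk _; rewrite !count_map; move: (x) => y {x ks}.
elim: s uv => [//|i s IHs] uv /=.
apply: leq_add; last by apply: IHs => j js; apply: uv; rewrite inE js orbT.
by case: (leP (v i)) => //= vx; rewrite (le_trans _ vx)// uv// mem_head.
Qed.

Lemma qhatE (R : realType) (m : nat) (tau : nat -> R) (q : R -> R) k :
  (1 <= k <= m)%N ->
  qhat m tau q k = nth 0 (sort <=%R [seq q (tau j) | j <- iota 1 m]) k.-1.
Proof. by rewrite /qhat; case: k => //= k ->. Qed.

Lemma qhat_homo (R : realType) (m : nat) (tau : nat -> R) (q : R -> R) k l :
  (1 <= k)%N -> (k <= l)%N -> (l <= m)%N -> qhat m tau q k <= qhat m tau q l.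
Proof.
move=> k1 kl lm; rewrite !qhatE ?k1 ?lm ?(leq_trans k1 kl) ?(leq_trans kl lm)//.
apply: sorted_leq_nth => //.
- exact: le_trans.
- exact: sort_le_sorted.
- by rewrite inE size_sort size_map size_iota; lia.
- by rewrite inE size_sort size_map size_iota; lia.
- lia.
Qed.

(** * The interpolant on one cell *)

(** Two distinct cells are always separated by inner nodes, which are sorted: it
    does not matter that the outer nodes 0 and 1 may be out of order. *)
Lemma FhatE (R : realType) (m : nat) (tau : nat -> R) (q : R -> R) k t :
    (k <= m)%N -> qhat m tau q k < t <= qhat m tau q k.+1 ->
  Fhat m tau q t = grid_ext m tau k + (grid_ext m tau k.+1 - grid_ext m tau k) *
       ((t - qhat m tau q k) / (qhat m tau q k.+1 - qhat m tau q k)).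
Proof.
move=> km tk; rewrite /Fhat big_mkord (bigD1 (Ordinal (km : (k < m.+1)%N)))//=.
rewrite indicE mem_set/= ?in_itv//= mulr1 big1 ?addr0// => -[j jm] /eqP jk.
rewrite indicE memNset/= ?mulr0// in_itv/= => /andP[jt tj].
have {}jk : j <> k by move=> e; apply: jk; apply/val_inj.
move/andP: tk => [kt tk].
have [jltk|kltj|//] := ltngtP j k.
  suff : t < t by rewrite ltxx.
  by apply: (le_lt_trans tj); apply: le_lt_trans kt; apply: qhat_homo.
suff : t < t by rewrite ltxx.
by apply: (le_lt_trans tk); apply: le_lt_trans jt; apply: qhat_homo.
Qed.

(** The cell is the first one whose right end is at least t.  The nodes 0 and 1
    at both ends guarantee that there is one and that t exceeds its left end. *)
Lemma qhat_locate (R : realType) (m : nat) (tau : nat -> R) (q : R -> R) t :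
    0 < t <= 1 ->
  exists2 k, (k <= m)%N & qhat m tau q k < t <= qhat m tau q k.+1.
Proof.
move=> /andP[t0 t1].
have ex : exists k, t <= qhat m tau q k.+1.
  by exists m; rewrite /qhat/= ltnn.
case: (ex_minnP ex) => k tk kmin; exists k.
  by apply: kmin; rewrite /qhat/= ltnn.
rewrite tk andbT; case: k tk kmin => [//|k] tk kmin.
by rewrite ltNge; apply/negP => /kmin; rewrite ltnn.
Qed.

(** * From errors on quantiles to errors on the distribution function *)

Lemma grid_le (R : realType) (taumin taumax : R) (m : nat) (tau : nat -> R) k l :
  is_grid taumin taumax m tau -> (1 <= k)%N -> (k <= l)%N -> (l <= m)%N ->
  tau k <= tau l.
Proof.
move=> [_ _ _ tauS] k1; elim: l => [|l IHl] kl lm; first lia.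
have [<-//|kl'] := eqVneq k l.+1.
by rewrite (le_trans (IHl _ _))//; [lia|lia|apply: ltW; apply: tauS; lia].
Qed.

Lemma grid_itv (R : realType) (taumin taumax : R) (m : nat) (tau : nat -> R) k :
  is_grid taumin taumax m tau -> (1 <= k <= m)%N ->
  taumin <= tau k <= taumax.
Proof.
move=> grid /andP[k1 km]; case: (grid) => m2 <- <- _.
by rewrite !(grid_le grid).
Qed.

Lemma coarseness_ge (R : realType) (m : nat) (tau : nat -> R) k :
  (1 <= k < m)%N -> tau k.+1 - tau k <= coarseness m tau.
Proof.
move=> km; apply: (@le_bigmax_seq _ _ _ _ _ k xpredT (fun k => tau k.+1 - tau k)) => //.
by rewrite mem_index_iota.
Qed.

(** The sequences Q (tau_k) - delta and Q (tau_k) + delta are already sorted, so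
    they are unchanged by the rearrangement and still enclose the rearranged
    estimates. *)
Lemma qhat_close (R : realType) (taumin taumax : R) (m : nat) (tau : nat -> R)
    (Q q : R -> R) (delta : R) k :
    is_grid taumin taumax m tau ->
    (forall s t, taumin <= s -> s <= t -> t <= taumax -> Q s <= Q t) ->
    (forall s, taumin <= s <= taumax -> `|Q s - q s| <= delta) ->
    (1 <= k <= m)%N ->
  `|Q (tau k) - qhat m tau q k| <= delta.
Proof.
move=> grid Qle Qq km; rewrite qhatE//.
have sorted_shift (c : R) :
    nth 0 (sort <=%R [seq Q (tau j) + c | j <- iota 1 m]) k.-1 = Q (tau k) + c.
  rewrite sort_le_id.
    rewrite (nth_map 0%N) ?size_iota; last lia.
    by rewrite nth_iota; [congr (Q (tau _) + _)|]; lia.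
  apply/(sortedP 0) => i; rewrite size_map size_iota => im.
  rewrite !(nth_map 0%N) ?size_iota ?nth_iota; [|lia..].
  rewrite lerD2r; apply: Qle.
  - by have /andP[] : taumin <= tau (1 + i)%N <= taumax by apply: (grid_itv grid); lia.
  - by apply: (grid_le grid); lia.
  - by have /andP[] : taumin <= tau (1 + i.+1)%N <= taumax by apply: (grid_itv grid); lia.
have /andP[lo hi] : Q (tau k) + - delta <= nth 0 (sort <=%R [seq q (tau j) | j <- iota 1 m]) k.-1 <=
   Q (tau k) + delta.
  rewrite -!sorted_shift; apply/andP; split; apply: le_nth_sort => j;
    rewrite mem_iota => jm;
    have : `|Q (tau j) - q (tau j)| <= delta by apply/Qq/(grid_itv grid); lia.
    by rewrite ler_norml; lra.
  by rewrite ler_norml; lra.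
by rewrite ler_norml; lra.
Qed.

(** On an outermost cell, a is the range of levels and w the length: a / w is the
    slope of the interpolant, and p the distance to the inner end. *)
Lemma edge_weight_le (R : realFieldType) (C a w p delta : R) :
  0 <= C -> 0 < w -> a <= C * w -> 0 <= p <= delta -> a * (p / w) <= C * delta.
Proof.
move=> C0 w0 aw /andP[p0 pd].
have a'C : a / w <= C by rewrite ler_pdivrMr.
rewrite mulrA mulrAC; apply: le_trans (_ : C * p <= _).
  exact: ler_wpM2r.
exact: ler_wpM2l.
Qed.

(** The coarseness accounts for an inner cell; in an outermost cell, C * delta
    bounds the deviation of F t from the level of the inner node, and again the
    deviation of the interpolant from this level. *)
Lemma Fhat_error (R : realType) (taumin taumax : R) (m : nat) (tau : nat -> R)
    (F Q q : R -> R) (C delta t : R) :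
    0 < taumin -> taumax < 1 -> is_grid taumin taumax m tau -> 0 <= C ->
    {homo F : s t / s <= t} ->
    (forall s t, s <= t -> F t - F s <= C * (t - s)) -> F 0 = 0 -> F 1 = 1 ->
    (forall s, taumin <= s <= taumax -> F (Q s) = s) ->
    (forall s, taumin <= s <= taumax -> `|Q s - q s| <= delta) ->
    Q taumin <= t <= Q taumax ->
  `|F t - Fhat m tau q t| <= coarseness m tau + C * delta *+ 2.
Proof.
move=> tmin0 tmax1 grid C0 Fle Flip F0 F1 FQ Qq /andP[Qt tQ].
case: (grid) => m2 tau1 taum tauS.
have m1 : (1 <= m)%N by lia.
have minmax : taumin <= taumax.
  by rewrite -tau1 -taum (grid_le grid).
have Qle s u : taumin <= s -> s <= u -> u <= taumax -> Q s <= Q u.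
  move=> ms; rewrite le_eqVlt => /predU1P[->//|su uM].
  rewrite leNgt; apply/negP => /ltW/Fle.
  by rewrite !FQ; lra.
have Fmin : F (Q taumin) = taumin by rewrite FQ// lexx.
have Fmax : F (Q taumax) = taumax by rewrite FQ// lexx andbT.
have Ft1 : taumin <= F t by rewrite -Fmin Fle.
have Ft2 : F t <= taumax by rewrite -Fmax Fle.
have t01 : 0 < t <= 1.
  apply/andP; split.
    by rewrite ltNge; apply/negP => /Fle; rewrite F0; lra.
  by rewrite leNgt; apply/negP => /ltW/Fle; rewrite F1; lra.
have delta0 : 0 <= delta.
  by apply: le_trans (Qq taumin _); rewrite ?lexx.
have kappa0 : 0 <= coarseness m tau.
  by apply: le_trans (coarseness_ge (k := 1%N) _ _); rewrite ?subr_ge0 ?ltW ?tauS//; lia.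
have Cd0 : 0 <= C * delta by rewrite mulr_ge0.
have close k : (1 <= k <= m)%N -> `|Q (tau k) - qhat m tau q k| <= delta.
  exact: (qhat_close grid Qle Qq).
(* Compare t with Q (tau k): beyond it, t is at most delta away from it. *)
have upper k : (1 <= k <= m)%N -> t <= qhat m tau q k -> F t <= tau k + C * delta.
  move=> km tqk; have [tQk|Qkt] := leP t (Q (tau k)).
    by have := Fle _ _ tQk; rewrite FQ ?(grid_itv grid)//; lra.
  have := Flip _ _ (ltW Qkt); rewrite FQ ?(grid_itv grid)// => Ft.
  have : C * (t - Q (tau k)) <= C * delta.
    by rewrite ler_wpM2l//; have := close _ km; rewrite ler_norml; lra.
  lra.
have lower k : (1 <= k <= m)%N -> qhat m tau q k < t -> tau k - C * delta <= F t.
  move=> km tqk; have [tQk|Qkt] := leP (Q (tau k)) t.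
    by have := Fle _ _ tQk; rewrite FQ ?(grid_itv grid)//; lra.
  have := Flip _ _ (ltW Qkt); rewrite FQ ?(grid_itv grid)// => Ft.
  have : C * (Q (tau k) - t) <= C * delta.
    by rewrite ler_wpM2l//; have := close _ km; rewrite ler_norml; lra.
  lra.
have [k km tk] := qhat_locate m tau q t01.
rewrite (FhatE km tk); case/andP: tk => kt tk.
set a := qhat _ _ _ k in kt *; set b := qhat _ _ _ k.+1 in tk *.
have ab : 0 < b - a by lra.
(* The cell below the smallest estimated quantile. *)
have [k0|k0] := posnP k.
  subst k; have -> : a = 0 by [].
  have -> : grid_ext m tau 1 = taumin by rewrite /grid_ext/= m1.
  have Ftle := upper 1%N m1 tk; rewrite tau1 in Ftle.
  have b0 : 0 < b by lra.
  have : taumin * ((b - t) / b) <= C * delta.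
    apply: edge_weight_le => //.
      have tQ1 : Q taumin - 0 <= b by lra.
      apply: le_trans (ler_wpM2l C0 tQ1).
      have Q0 : 0 <= Q taumin.
        by rewrite leNgt; apply/negP => /ltW/Fle; lra.
      by have := Flip _ _ Q0; rewrite Fmin F0 subr0.
    by have := close 1%N m1; rewrite tau1 ler_norml -/b; lra.
  have : 0 <= taumin * ((b - t) / b).
    by rewrite mulr_ge0 ?divr_ge0//; lra.
  rewrite /grid_ext/= add0r !subr0.
  have -> : taumin * ((b - t) / b) = taumin - taumin * (t / b).
    by rewrite mulrBl mulrBr divff ?mulr1 ?gt_eqF.
  rewrite ler_norml; lra.
have gk : grid_ext m tau k = tau k by rewrite /grid_ext gtn_eqF// km.
have x0 : 0 <= (t - a) / (b - a) by rewrite divr_ge0//; lra.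
(* The cell above the largest estimated quantile. *)
have [mk|kltm] := leqP m k.
  have {mk km} km : k = m by apply/eqP; rewrite eqn_leq km mk.
  subst k; rewrite gk /grid_ext/= ltnn taum.
  have b1 : b = 1 by rewrite /b /qhat/= ltnn.
  have := lower m _ kt; rewrite taum m1 leqnn => /(_ isT) tFt.
  have : (1 - taumax) * ((t - a) / (b - a)) <= C * delta.
    apply: edge_weight_le => //.
      have tb : 1 - t <= b - a by lra.
      apply: le_trans (ler_wpM2l C0 tb).
      by have := Flip t 1; rewrite F1; lra.
    by have := close m; rewrite taum m1 leqnn ler_norml -/a; lra.
  have : 0 <= (1 - taumax) * ((t - a) / (b - a)) by rewrite mulr_ge0//; lra.
  rewrite ler_norml; lra.
rewrite gk /grid_ext/= kltm.
have x1 : (t - a) / (b - a) <= 1 by rewrite ler_pdivrMr// mul1r; lra.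
have := lower k _ kt; rewrite k0 km => /(_ isT).
have := upper k.+1 _ tk; rewrite kltm => /(_ isT).
have kk : (1 <= k < m)%N by rewrite k0 kltm.
have := coarseness_ge tau kk; have := tauS _ kk.
set x := (t - a) / (b - a) in x0 x1 *.
move=> tk1 kap up lo.
have : (tau k.+1 - tau k) * x <= tau k.+1 - tau k by rewrite ler_piMr//; lra.
have : 0 <= (tau k.+1 - tau k) * x by rewrite mulr_ge0//; lra.
rewrite ler_norml; lra.
Qed.

(** * Conditional distribution functions with a bounded density *)

Section cond_law.
Variables (R : realType) (d : nat) (K : R.-pker (covT R d) ~> (measurableTypeR R)).
Variables (S : set (covT R d)) (f : R -> covT R d -> R) (C : R) (z : covT R d).
Hypothesis (fK : is_cond_density K S f) (Sz : S z) (K01 : K z `[0, 1]%classic = 1%E).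
Hypothesis (fC : forall x, 0 <= x <= 1 -> f x z <= C).
Hypothesis (Fcont : continuous (fun t : R => condF K t z)).

Let C_ge0 : 0 <= C.
Proof.
by case: fK => _ f0 _; rewrite (le_trans (f0 0 z))// fC// lexx ler01.
Qed.

Let kernel_fin_num (A : set (measurableTypeR R)) :
  measurable A -> K z A \is a fin_num.
Proof.
move=> mA; rewrite ge0_fin_numE//; apply: le_lt_trans (ltry 1).
rewrite -(prob_kernel (s := K) z); apply: le_measure; rewrite ?inE//.
Qed.

(** The density is only bounded on [0, 1], which carries all the mass. *)
Let kernel_unit_itv (A : set (measurableTypeR R)) :
  measurable A -> K z A = K z (A `&` `[0, 1]%classic).
Proof.
move=> mA.
have m01 : measurable (`[0, 1]%classic : set (measurableTypeR R)) by exact: measurable_itv.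
have K01C : K z (~` `[0, 1]%classic) = 0%E.
  have mC := measurableC m01.
  have KU : 1%E = (K z `[0%R, 1%R]%classic + K z (~` `[0%R, 1%R]%classic))%E.
    rewrite -measureU ?setICr// setUCr; exact/esym/prob_kernel.
  move: KU (kernel_fin_num mC); rewrite K01.
  by case: (K z _) => [r [] r1 _| |]//; congr EFin; lra.
rewrite [LHS](measureDI (K z) mA m01) [X in (X + _)%E](_ : _ = 0%E) ?add0e//.
apply/eqP; rewrite eq_le measure_ge0 andbT -[leRHS]K01C.
by apply: le_measure; rewrite ?inE//; [exact: measurableD|exact: measurableC].
Qed.

Lemma cond_law_le_lebesgue (A : set (measurableTypeR R)) :
  measurable A -> (K z A <= C%:E * lebesgue_measure (A `&` `[0%R, 1%R]%classic))%E.
Proof.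
move=> mA; case: fK => mf f0 fE.
have m01 : measurable (`[0, 1]%classic : set (measurableTypeR R)) by exact: measurable_itv.
rewrite kernel_unit_itv// fE//; last exact: measurableI.
set B := A `&` _; have mB : measurable B by exact: measurableI.
rewrite -integral_cst//; apply: ge0_le_integral => //.
- by move=> x _; rewrite lee_fin.
- have mfz : measurable_fun [set: measurableTypeR R] (fun x => f x z).
    exact: (measurableT_comp mf (pair2_measurable z)).
  by apply/measurable_EFinP; exact: measurable_funS mfz.
- by move=> x [_ /=]; rewrite in_itv/= lee_fin => /fC.
Qed.

Lemma condF_le : {homo (fun t => condF K t z) : s t / s <= t}.
Proof.
move=> s t st; apply: fine_le; [exact: kernel_fin_num..|].
apply: le_measure; rewrite ?inE//; exact: subset_itvl.
Qed.

Lemma condF_lipschitz s t : s <= t -> condF K t z - condF K s z <= C * (t - s).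
Proof.
move=> st; rewrite /condF.
have -> : `]-oo, t]%classic = `]-oo, s]%classic `|` `]s, t]%classic :> set R.
  by rewrite -itv_bndbnd_setU ?bnd_simp.
rewrite measureU//; last first.
  rewrite -subset0 => x [/=]; rewrite !in_itv/= => ? /andP[]; lra.
rewrite fineD ?kernel_fin_num// addrAC subrr add0r.
rewrite -lee_fin fineK ?kernel_fin_num//.
apply: le_trans (cond_law_le_lebesgue _) _ => //.
rewrite EFinM lee_wpmul2l ?lee_fin//.
apply: (@le_trans _ _ (lebesgue_measure (`]s, t]%classic : set R))).
  by apply: le_measure; rewrite ?inE//; exact: measurableI.
rewrite lebesgue_measure_itv/= lte_fin; case: ifP => _; first by rewrite EFinB.
by rewrite lee_fin subr_ge0.
Qed.

Lemma condF_0 : condF K 0 z = 0.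
Proof.
apply/eqP; rewrite eq_le fine_ge0// andbT -lee_fin fineK ?kernel_fin_num//.
apply: le_trans (cond_law_le_lebesgue _) _ => //.
have -> : `]-oo, 0]%classic `&` `[0, 1]%classic = [set 0] :> set R.
  apply/seteqP; split => x /=; rewrite !in_itv/=.
    by move=> [x0 /andP[x0' _]]; apply/eqP; rewrite eq_le x0.
  by move=> ->; rewrite lexx ler01.
by rewrite lebesgue_measure_set1 mule0.
Qed.

Lemma condF_1 : condF K 1 z = 1.
Proof.
apply/eqP; rewrite eq_le -!lee_fin fineK ?kernel_fin_num//.
rewrite kernel_unit_itv//.
rewrite setIidr ?K01 ?lexx//.
by move=> x/=; rewrite !in_itv/= => /andP[].
Qed.

(** The inequality F (Q tau) <= tau comes from a level-tau point given by the
    intermediate value theorem, the converse one from the Lipschitz bound applied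
    between Q tau and points of the defining set close to it. *)
Lemma condF_condQ tau : 0 < tau < 1 -> condF K (condQ K tau z) z = tau.
Proof.
move=> /andP[tau0 tau1]; set A := [set t | 0 <= t <= 1 /\ tau <= condF K t z].
have A1 : A 1 by split; rewrite ?lexx ?ler01// condF_1 ltW.
have lbA : has_lbound A by exists 0 => x [/andP[]].
apply/eqP; rewrite eq_le; apply/andP; split.
  have [] := @IVT R (fun t => condF K t z) 0 1 tau ler01.
  - exact: continuous_subspaceT.
  - by rewrite condF_0 condF_1 minEle maxEle ler01 !ltW.
  move=> c; rewrite in_itv/= => c01 Fc; rewrite -[leRHS]Fc; apply: condF_le.
  by apply: ge_inf => //; split; rewrite ?Fc.
apply/ler_addgt0Pr => e e0.
have [] := @inf_adherent R A (e / (C + 1)) _ _.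
- by rewrite divr_gt0// ltr_wpDl.
- by split=> //; exists 1.
move=> s As /ltW se; have Qs : condQ K tau z <= s by exact: ge_inf.
have : C * (s - condQ K tau z) <= e.
  apply: (@le_trans _ _ ((C + 1) * (s - condQ K tau z))).
    by rewrite ler_wpM2r ?subr_ge0// lerDl.
  by rewrite mulrC -ler_pdivlMr ?ltr_wpDl// lerBlDl.
have := condF_lipschitz Qs; case: As => _; lra.
Qed.
End cond_law.

(** * Uniform boundedness in probability *)

(** The first n0 indices, where the asymptotic comparison does not apply yet, are
    absorbed in the constant by adding up their ratios. *)
Lemma littleo_bound (R : realType) (u g : nat -> R) :
  (forall n, (0 < n)%N -> g n != 0) -> u =o_\oo g ->
  exists2 c : R, 0 < c & forall n, (0 < n)%N -> u n <= c * `|g n|.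
Proof.
move=> g0 /eqoP/(_ 1 ltr01)[n0 _ ug].
exists (1 + \sum_(0 <= i < n0) `|u i| / `|g i|).
  by rewrite ltr_wpDr// sumr_ge0// => i _; rewrite divr_ge0.
move=> n n1; have [n0n|nn0] := leqP n0 n.
  apply: le_trans (ler_norm _) _; apply: le_trans (ug _ n0n) _.
  by rewrite ler_wpM2r// lerDl sumr_ge0// => i _; rewrite divr_ge0.
rewrite -ler_pdivrMr ?normr_gt0 ?g0//.
apply: le_trans (_ : `|u n| / `|g n| <= _).
  by rewrite ler_wpM2r ?invr_ge0// ler_norm.
rewrite big_mkord (bigD1 (Ordinal nn0))//= addrCA lerDl addr_ge0// sumr_ge0// => i _.
Qed.


Lemma abse_div_le (R : realType) (x : \bar R) (r B : R) : r != 0 ->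
  (`|x * r^-1%:E| <= B%:E)%E = (`|x| <= (B * `|r|)%:E)%E.
Proof.
move=> r0; rewrite abseM/= normfV lee_pdivrMr ?normr_gt0//.
Qed.

(** [Fhat_error] at every point of S.  If S is empty, both suprema are -oo, whose
    absolute value exceeds every real: then the premise on the quantile error
    fails. *)
Lemma sup_norm_le_quantile_error (R : realType) (d : nat) (taumin taumax : R)
    (K : R.-pker (covT R d) ~> (measurableTypeR R)) (S : set (covT R d))
    (f : R -> covT R d -> R) (C : R) (m : nat) (tau : nat -> R)
    (q : R -> covT R d -> R) (delta : R) :
    0 < taumin -> taumin < taumax -> taumax < 1 ->
    is_grid taumin taumax m tau -> is_cond_density K S f ->
    (forall z, S z -> K z `[0, 1]%classic = 1%E) ->
    (forall z, S z -> continuous (fun t : R => condF K t z)) ->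
    (forall z x, S z -> 0 <= x <= 1 -> f x z <= C) -> 0 <= C ->
    (`|quantile_error K taumin taumax S q| <= delta%:E)%E ->
  (`|quantile_sup_norm K taumin taumax S
     (fun t z => (condF K t z - Fhat m tau (q^~ z) t)%R)| <=
   (coarseness m tau + C * delta *+ 2)%:E)%E.
Proof.
move=> tmin0 minmax tmax1 grid fK K01 Fcont fC C0.
set D := quantile_error _ _ _ _ _; set X := quantile_sup_norm _ _ _ _ _.
move=> Ddelta.
have [S0|/set0P[z0 Sz0]] := eqVneq S set0.
  suff D0 : D = -oo%E by rewrite D0 in Ddelta.
  apply/eqP; rewrite -leeNy_eq; apply: ge_ereal_sup => x [z [s [Sz _ _]]].
  by rewrite S0 in Sz.
have itv01 s : taumin <= s <= taumax -> 0 < s < 1.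
  by move=> /andP[ms sM]; rewrite (lt_le_trans tmin0 ms) (le_lt_trans sM tmax1).
have Qq z s : S z -> taumin <= s <= taumax ->
    `|condQ K s z - q s z| <= delta.
  move=> Sz sT; rewrite -lee_fin; apply: le_trans Ddelta.
  apply: le_trans (lee_abs _); apply: ereal_sup_ubound.
  by exists z, s.
have FQ z s : S z -> taumin <= s <= taumax -> condF K (condQ K s z) z = s.
  move=> Sz /itv01.
  by apply: (condF_condQ fK Sz) => //; [exact: K01|move=> x; exact: fC|exact: Fcont].
rewrite gee0_abs.
  apply: ge_ereal_sup => _ [z [t [Sz tQ ->]]]; rewrite lee_fin.
  apply: (Fhat_error (taumin := taumin) (taumax := taumax)
    (F := fun t => condF K t z) (Q := fun s => condQ K s z)) => //.
  - exact: condF_le.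
  - by apply: (condF_lipschitz fK Sz) => //; [exact: K01|move=> x; exact: fC].
  - by apply: (condF_0 fK Sz) => //; [exact: K01|move=> x; exact: fC].
  - by apply: condF_1; exact: K01.
  - by move=> s; exact: FQ.
  - by move=> s; exact: Qq.
pose t := condQ K taumin z0.
apply: (@le_trans _ _ `|condF K t z0 - Fhat m tau (q^~ z0) t|%:E).
  by rewrite lee_fin.
apply: ereal_sup_ubound; exists z0, t; split=> //; rewrite lexx/= leNgt.
apply/negP => /ltW/(condF_le K z0); rewrite !FQ ?lexx ?(ltW minmax)//.
by rewrite leNgt minmax.
Qed.

Theorem theorem7 (R : realType) (d : nat) (taumin taumax : R)
    (htau : [/\ 0 < taumin, taumin < taumax & taumax < 1])
    (P0 : set (law R d)) (hP0 : P0 `<=` @calP R d)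
    (K : law R d -> R.-pker (covT R d) ~> (measurableTypeR R))
    (hK : forall P, P0 P -> continuous_cond_law P (K P))
    (dO : measure_display) (Omega : measurableType dO)
    (Pr : law R d -> probability Omega R) (V : nat -> Omega -> pairT R d)
    (hV : forall P, P0 P -> iid_sample P (Pr P) V)
    (Qhat : forall n : nat, n.-tuple (pairT R d) -> R -> covT R d -> R)
    (m : nat -> nat) (tau : nat -> nat -> R)
    (hgrid : forall n, (0 < n)%N -> is_grid taumin taumax (m n) (tau n))
    (hequi : forall n, (0 < n)%N -> equidistant (m n) (tau n))
    (g : nat -> R) (hg0 : forall n, (0 < n)%N -> g n != 0)
    (hg : g n @[n --> \oo] --> 0)
    (N : law R d -> set (covT R d))
    (hN : forall P, P0 P -> P.-negligible [set w : tripleT R d | N P w.2])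
    (f : law R d -> R -> covT R d -> R)
    (hf : forall P, P0 P -> is_cond_density (K P) (@cube R d `\` N P) (f P))
    (hi : unif_bounded_in_prob P0 Pr
            (fun P n w => quantile_error (K P) taumin taumax
               (@cube R d `\` N P)
               (Qhat n [tuple V i w | i < n]))
            g)
    (hii : exists C : R, forall P, P0 P ->
       forall z, (@cube R d `\` N P) z ->
         (ereal_sup [set (f P x z)%:E | x in [set x : R | (0 <= x <= 1)%R]] <= C%:E)%E)
    (hkappa : (fun n => coarseness (m n) (tau n)) =o_\oo g) :
  unif_bounded_in_prob P0 Pr
    (fun P n w => quantile_sup_norm (K P) taumin taumax
       (@cube R d `\` N P)
       (fun t z => condF (K P) t z -
          Fhat (m n) (tau n)
            (fun s => Qhat n [tuple V i w | i < n] s z) t))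
    g.
Proof.
case: htau => tmin0 minmax tmax1; case: hii => C fC.
have [c c0 kappac] := littleo_bound hg0 hkappa.
move=> e e0; have [B B0 DB] := hi e e0.
(* The bound on the coarseness plus twice C * delta, with delta = B * |g n|. *)
exists (c + `|C| * B *+ 2).
  by rewrite ltr_wpDr// mulrn_wge0// mulr_ge0// ltW.
apply: le_lt_trans DB; apply: ge_ereal_sup => _ [n [P [n0 PP ->]]].
apply: (@le_trans _ _ ((Pr P)^* [set w | B%:E < `| quantile_error (K P) taumin taumax
               (@cube R d `\` N P)
               (Qhat n [tuple V i w | i < n]) * (g n)^-1%:E |])%mu)%E; last first.
  by apply: ereal_sup_ubound; exists n, P.
apply: le_mu_ext => w /=; apply: contraTT; rewrite -!leNgt !abse_div_le ?hg0//.
have [_ hKP] := hK P PP.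
move=> /(sup_norm_le_quantile_error tmin0 minmax tmax1 (hgrid n n0) (hf P PP)).
move=> /(_ `|C|) Xle; apply: le_trans (Xle _ _ _ _) _ => //.
- by move=> z [/hKP[]].
- by move=> z [/hKP[]].
- move=> z x Sz x01; apply: le_trans (ler_norm C); rewrite -lee_fin.
  by apply: le_trans (fC P PP z Sz); apply: ereal_sup_ubound; exists x.
by rewrite lee_fin mulrDl mulrnAl mulrA lerD2r kappac.
Qed.
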